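(* Let $n\geq 1$. Then $V^{\otimes n}$ is a $b_n(q,m)$-module with $U_i$, $1\le i\le n-1$, acting through $T_{i+1}-q$ and $U_0$ acting through $T_1-\lambda_1$.
   Context: Setting: $k$ is an algebraically closed field, $q\in k^\times$ with $q^4\neq 1$, $m$ is an integer, $\lambda_1=\frac{q^m}{q-q^{-1}}$, $\lambda_2=\frac{q^{-m}}{q-q^{-1}}$, and it is assumed that $\lambda_1\ne\lambda_2$ and $\lambda_1\neq q^2\lambda_2$. Write $[r]=\frac{q^r-q^{-r}}{q-q^{-1}}$. The blob algebra $b_n=b_n(q,m)$ is the unital $k$-algebra on generators $U_0,U_1,\dots,U_{n-1}$ with relations $U_iU_jU_i=U_i$ for $i,j\ge 1$, $|i-j|=1$; $U_i^2=-[2]U_i$ for $i\ge1$; $U_0^2=-[m]U_0$; $U_1U_0U_1=[m-1]U_1$; and $U_iU_j=U_jU_i$ for $|i-j|\ge 2$. Let $V$ be a $k$-vector space with basis $v_1,v_2$. Define $R\in \operatorname{End}_k(V\otimes V)$ by $R(v_i\otimes v_i)=q\,v_i\otimes v_i$ ($i=1,2$), $R(v_2\otimes v_1)=v_1\otimes v_2$, $R(v_1\otimes v_2)=v_2\otimes v_1+(q-q^{-1})v_1\otimes v_2$. For $1\le i\le n-1$ put $T_{i+1}=\mathrm{Id}^{\otimes (i-1)}\otimes R\otimes \mathrm{Id}^{\otimes (n-i-1)}\in\operatorname{End}_k(V^{\otimes n})$; these are invertible. For $2\le j\le n$ let $S_j\in\operatorname{End}_k(V^{\otimes n})$ be the linear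 map which on a basis vector $v=v_{i_1}\otimes\cdots\otimes v_{i_n}$ is $S_j(v)=qv$ if $i_{j-1}=i_j$, and which interchanges the tensor factors in positions $j-1$ and $j$ of $v$ if $i_{j-1}\ne i_j$. Let $\varpi(v_{i_1}\otimes\cdots\otimes v_{i_n})=\lambda_{i_1}\,v_{i_1}\otimes\cdots\otimes v_{i_n}$, $\theta=S_nS_{n-1}\cdots S_2$ and $T_1=T_2^{-1}T_3^{-1}\cdots T_n^{-1}\,\theta\,\varpi$. *)

(* Defs.v *)
From HB Require Import structures.
From mathcomp Require Import all_boot all_order perm all_algebra.
From mathcomp Require Import boolp.
From mathcomp.multinomials Require Import monalg.

Set Implicit Arguments.
Unset Strict Implicit.
Unset Printing Implicit Defensive.

Import GRing.Theory.
Local Open Scope ring_scope.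
Local Open Scope quotient_scope.

Definition qint (k : fieldType) (q : k) (r : int) : k :=
  (q ^ r - q ^ (- r)) / (q - q^-1).

Definition lambda1 (k : fieldType) (q : k) (m : int) : k :=
  q ^ m / (q - q^-1).

Definition lambda2 (k : fieldType) (q : k) (m : int) : k :=
  q ^ (- m) / (q - q^-1).

(* The algebra of a noncommutative free monoid has no algType instance in
   multinomials, only an lalgType one. *)
Definition free_alg (k : fieldType) (n : nat) := {malg k[{fmonom 'I_n}]}.

Section FreeAlgebra.
Variables (k : fieldType) (n : nat).

HB.instance Definition _ := GRing.Lalgebra.on (free_alg k n).

Fact free_scalerAr (c : k) (x y : free_alg k n) : c *: (x * y) = x * (c *: y).
Proof.
rewrite -!mul_malgC mulrA [RHS]mulrA; congr (_ * _).
rewrite [LHS]fgmulUg [RHS]fgmulgU; apply: eq_bigr => u _.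
by rewrite mul1m mulm1 mulrC.
Qed.

HB.instance Definition _ :=
  GRing.Lalgebra_isAlgebra.Build k (free_alg k n) free_scalerAr.

Definition free_gen (i : 'I_n) : free_alg k n := << fmu i >>.

End FreeAlgebra.

Section BlobAlgebra.
Variables (k : fieldType) (q : k) (m : int) (n : nat).
Local Notation F := (free_alg k n).
Local Notation x := (@free_gen k n).

Inductive blob_relation : F -> F -> Prop :=
| BlobBraid (i j : 'I_n) of (0 < i)%N & (0 < j)%N
    & (i.+1 == j) || (j.+1 == i) :
    blob_relation (x i * x j * x i) (x i)
| BlobSquare (i : 'I_n) of (0 < i)%N :
    blob_relation (x i * x i) (- qint q 2 *: x i)
| BlobSquare0 (i : 'I_n) of i = 0%N :> nat :
    blob_relation (x i * x i) (- qint q m *: x i)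
| BlobMixed (i j : 'I_n) of i = 0%N :> nat & j = 1%N :> nat :
    blob_relation (x j * x i * x j) (qint q (m - 1) *: x j)
| BlobComm (i j : 'I_n) of (i.+2 <= j)%N || (j.+2 <= i)%N :
    blob_relation (x i * x j) (x j * x i).

(* The two-sided ideal generated by the differences l - r of the relations. *)
Inductive in_blob_ideal : F -> Prop :=
| InIdeal0 : in_blob_ideal 0
| InIdealD (a b l r y : F) of blob_relation l r & in_blob_ideal y :
    in_blob_ideal (a * (l - r) * b + y).

Definition blob_ideal : {pred F} := fun y => `[< in_blob_ideal y >].

Lemma blob_idealP y : reflect (in_blob_ideal y) (y \in blob_ideal).
Proof. exact: asboolP. Qed.

Fact blob_ideal_zmod : zmod_closed blob_ideal.
Proof.
have addI u v : in_blob_ideal u -> in_blob_ideal v -> in_blob_ideal (u + v).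
  elim=> [|a b l r y lr _ IH] hv; first by rewrite add0r.
  by rewrite -addrA; apply: InIdealD lr _; apply: IH.
have oppI u : in_blob_ideal u -> in_blob_ideal (- u).
  elim=> [|a b l r y lr _ IH]; first by rewrite oppr0; apply: InIdeal0.
  by rewrite opprD -!mulNr; apply: InIdealD lr IH.
split=> [|u v /blob_idealP hu /blob_idealP hv].
  by apply/blob_idealP; apply: InIdeal0.
by apply/blob_idealP; apply: addI => //; apply: oppI.
Qed.

HB.instance Definition _ := GRing.isZmodClosed.Build F blob_ideal blob_ideal_zmod.

Lemma blob_idealMl a u : u \in blob_ideal -> a * u \in blob_ideal.
Proof.
move=> /blob_idealP; elim=> [|b c l r y lr _ /blob_idealP IH].
  by rewrite mulr0 rpred0.
apply/blob_idealP; rewrite mulrDr !mulrA -(mulrA (a * b)) mulrA.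
exact: InIdealD lr IH.
Qed.

Lemma blob_idealMr a u : u \in blob_ideal -> u * a \in blob_ideal.
Proof.
move=> /blob_idealP; elim=> [|b c l r y lr _ /blob_idealP IH].
  by rewrite mul0r rpred0.
apply/blob_idealP; rewrite mulrDl -(mulrA (b * _)).
exact: InIdealD lr IH.
Qed.

Lemma blob_idealZ (c : k) u : u \in blob_ideal -> c *: u \in blob_ideal.
Proof. by move=> hu; rewrite -[u]mul1r scalerAl blob_idealMl. Qed.

Lemma blob_relation_mcoeff1 l r : blob_relation l r -> (l - r)@_mone = 0.
Proof.
have x0 i : (x i)@_mone = 0.
  rewrite /free_gen mcoeffU1; case: eqP => // /(congr1 (@fmonom_val _)).
  by rewrite fm1 fmU.
by case=> *; rewrite mcoeffB ?mcoeffZ !rmorphM /= !x0 !(mul0r, mulr0, subr0).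
Qed.

Lemma blob_ideal1 : 1 \notin blob_ideal.
Proof.
suff H u : in_blob_ideal u -> u@_mone = 0.
  by apply/blob_idealP => /H /eqP; rewrite mcoeff1 eqxx oner_eq0.
elim=> [|a b l r y lr _ IH]; first exact: mcoeff0.
rewrite mcoeffD IH addr0 rmorphM /= rmorphM /= blob_relation_mcoeff1 //.
by rewrite mulr0 mul0r.
Qed.

(* The blob algebra b_n(q,m): the quotient of the free algebra by the ideal. *)
Definition blob := Quotient.quot blob_ideal.

HB.instance Definition _ := GRing.Zmodule.on blob.
HB.instance Definition _ := EqQuotient.on blob.

Definition blob_pi : F -> blob := \pi_blob.

Lemma blob_piE u v : (blob_pi u == blob_pi v) = (u - v \in blob_ideal).
Proof. by rewrite Quotient.idealrBE. Qed.

Lemma blob_reprK a : blob_pi (repr a) = a.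
Proof. exact: reprK. Qed.

Lemma blob_piD u v : blob_pi (u + v) = blob_pi u + blob_pi v.
Proof. by rewrite /blob_pi !piE. Qed.

Lemma blob_pi_ind (P : blob -> Prop) : (forall u, P (blob_pi u)) -> forall a, P a.
Proof. by move=> H a; rewrite -[a]blob_reprK. Qed.

Definition blob_one : blob := blob_pi 1.
Definition blob_mul (a b : blob) : blob := blob_pi (repr a * repr b).
Definition blob_scale (c : k) (a : blob) : blob := blob_pi (c *: repr a).

Lemma blob_repr_pi u : u - repr (blob_pi u) \in blob_ideal.
Proof. by rewrite -blob_piE blob_reprK. Qed.

Lemma blob_mulE u v : blob_mul (blob_pi u) (blob_pi v) = blob_pi (u * v).
Proof.
apply/esym/eqP; rewrite blob_piE.
set u' := repr _; set v' := repr _.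
have -> : u * v - u' * v' = (u - u') * v + u' * (v - v').
  by rewrite mulrBl mulrBr addrA subrK.
apply: rpredD; first exact/blob_idealMr/blob_repr_pi.
exact/blob_idealMl/blob_repr_pi.
Qed.

Lemma blob_scaleE c u : blob_scale c (blob_pi u) = blob_pi (c *: u).
Proof.
by apply/esym/eqP; rewrite blob_piE -scalerBr; apply/blob_idealZ/blob_repr_pi.
Qed.

Fact blob_mulA : associative blob_mul.
Proof.
elim/blob_pi_ind=> u; elim/blob_pi_ind=> v; elim/blob_pi_ind=> w.
by rewrite !blob_mulE mulrA.
Qed.
Fact blob_mul1 : left_id blob_one blob_mul.
Proof. by elim/blob_pi_ind=> u; rewrite blob_mulE mul1r. Qed.
Fact blob_1mul : right_id blob_one blob_mul.
Proof. by elim/blob_pi_ind=> u; rewrite blob_mulE mulr1. Qed.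
Fact blob_mulDl : left_distributive blob_mul +%R.
Proof.
elim/blob_pi_ind=> u; elim/blob_pi_ind=> v; elim/blob_pi_ind=> w.
by rewrite -blob_piD !blob_mulE mulrDl blob_piD.
Qed.
Fact blob_mulDr : right_distributive blob_mul +%R.
Proof.
elim/blob_pi_ind=> u; elim/blob_pi_ind=> v; elim/blob_pi_ind=> w.
by rewrite -blob_piD !blob_mulE mulrDr blob_piD.
Qed.
Fact blob_one_neq0 : blob_one != 0.
Proof.
have -> : 0 = blob_pi 0 by rewrite /blob_pi !piE.
by rewrite blob_piE subr0 blob_ideal1.
Qed.

HB.instance Definition _ := GRing.Zmodule_isNzRing.Build blob
  blob_mulA blob_mul1 blob_1mul blob_mulDl blob_mulDr blob_one_neq0.

Fact blob_scaleA c d a : blob_scale c (blob_scale d a) = blob_scale (c * d) a.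
Proof. by elim/blob_pi_ind: a => u; rewrite !blob_scaleE scalerA. Qed.
Fact blob_scale1 : left_id 1 blob_scale.
Proof. by elim/blob_pi_ind=> u; rewrite blob_scaleE scale1r. Qed.
Fact blob_scaleDr : right_distributive blob_scale +%R.
Proof.
move=> c; elim/blob_pi_ind=> u; elim/blob_pi_ind=> v.
by rewrite -blob_piD !blob_scaleE scalerDr blob_piD.
Qed.
Fact blob_scaleDl a : {morph blob_scale^~ a : c d / c + d}.
Proof.
by elim/blob_pi_ind: a => u c d; rewrite !blob_scaleE scalerDl blob_piD.
Qed.

HB.instance Definition _ := GRing.Zmodule_isLmodule.Build k blob
  blob_scaleA blob_scale1 blob_scaleDr blob_scaleDl.

Fact blob_scaleAl (c : k) (a b : blob) : c *: (a * b) = c *: a * b.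
Proof.
elim/blob_pi_ind: a => u; elim/blob_pi_ind: b => v.
rewrite -[LHS]/(blob_scale c (blob_mul _ _)).
rewrite -[RHS]/(blob_mul (blob_scale c _) _).
by rewrite !(blob_scaleE, blob_mulE) scalerAl.
Qed.
Fact blob_scaleAr (c : k) (a b : blob) : c *: (a * b) = a * (c *: b).
Proof.
elim/blob_pi_ind: a => u; elim/blob_pi_ind: b => v.
rewrite -[LHS]/(blob_scale c (blob_mul _ _)).
rewrite -[RHS]/(blob_mul _ (blob_scale c _)).
by rewrite !(blob_scaleE, blob_mulE) scalerAr.
Qed.

HB.instance Definition _ := GRing.Lmodule_isLalgebra.Build k blob blob_scaleAl.
HB.instance Definition _ := GRing.Lalgebra_isAlgebra.Build k blob blob_scaleAr.

Definition blobU (i : 'I_n) : blob := blob_pi (x i).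

Lemma blob_pi_mul u v : blob_pi (u * v) = blob_pi u * blob_pi v.
Proof. by rewrite -blob_mulE. Qed.

Lemma blob_pi_scale c u : blob_pi (c *: u) = c *: blob_pi u.
Proof. by rewrite -blob_scaleE. Qed.

Lemma blob_relation_pi l r : blob_relation l r -> blob_pi l = blob_pi r.
Proof.
move=> lr; apply/eqP; rewrite blob_piE; apply/blob_idealP.
by rewrite -[_ - _]addr0 -[l - r]mulr1 -[l - r]mul1r; apply: InIdealD InIdeal0.
Qed.

End BlobAlgebra.

(* A module over the k-algebra A on the k-space W, given by its structure map
   rho : A -> End_k(W). *)
Definition is_module_structure (k : fieldType) (A : algType k) (W : vectType k)
    (rho : A -> 'End(W)) : Prop :=
  [/\ linear rho,
      rho 1 = \1%VF
    & forall a b : A, rho (a * b) = (rho a \o rho b)%VF].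

(* V has basis v_1, v_2, indexed here by 0, 1 : 'I_2.  The tensor power of V is
   the space of coordinate families with respect to the basis of pure tensors
   v_{w 0} (x) ... (x) v_{w (n-1)}, where w ranges over the words below. *)
Definition word (n : nat) := {ffun 'I_n -> 'I_2}.

Definition tpow (k : fieldType) (n : nat) : vectType k := {ffun word n -> k^o}.

Definition pure (k : fieldType) (n : nat) (w : word n) : tpow k n :=
  [ffun u => (u == w)%:R].

Definition lin_ext (k : fieldType) (n : nat) (W : vectType k)
    (g : word n -> W) : 'Hom(tpow k n, W) :=
  linfun (fun t : tpow k n => \sum_(w : word n) (t w : k) *: g w).

Lemma lin_extE (k : fieldType) (n : nat) (W : vectType k) (g : word n -> W)
  (w : word n) : lin_ext g (pure k w) = g w.
Proof.
have lin : linear (fun t : tpow k n => \sum_(w : word n) (t w : k) *: g w).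
  move=> c s t; rewrite scaler_sumr -big_split /=; apply: eq_bigr => u _.
  by rewrite !ffunE scalerDl scalerA.
pose f := GRing.isLinear.Build k (tpow k n) W _ _ lin.
pose h : {linear tpow k n -> W} := HB.pack (fun t : tpow k n => \sum_w (t w : k) *: g w) f.
rewrite /lin_ext -[linfun _]/(linfun h) lfunE /= (bigD1 w) //= !ffunE eqxx scale1r.
by rewrite big1 ?addr0 // => u /negPf uw; rewrite ffunE uw scale0r.
Qed.

Section TensorSpace.
Variables (k : fieldType) (q : k) (m : int).

Definition pair_word (a b : 'I_2) : word 2 :=
  [ffun c => if c == ord0 then a else b].

Definition opR : 'End(tpow k 2) :=
  lin_ext (fun w : word 2 =>
    let a := w ord0 in let b := w ord_max in
    if a == b then q *: pure k (pair_word a a)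
    else if (a == ord_max) && (b == ord0) then pure k (pair_word b a)
    else pure k (pair_word b a) + (q - q^-1) *: pure k (pair_word a b)).

Variable n : nat.

Definition subst_word (w : word n) (i j : 'I_n) (u : word 2) : word n :=
  [ffun c => if c == i then u ord0 else if c == j then u ord_max else w c].

(* The endomorphism f of V (x) V acting on the i-th and j-th tensor factors
   and the identity acting on all other factors. *)
Definition act_at (f : 'End(tpow k 2)) (i j : 'I_n) : 'End(tpow k n) :=
  lin_ext (fun w : word n =>
    \sum_(u : word 2)
      (f (pure k (pair_word (w i) (w j))) u : k) *: pure k (subst_word w i j u)).

(* With 0-based positions, for 0 < i < n the operators opT i and opS i act on
   the adjacent factors i - 1 and i: they are T_{i+1} and S_{i+1}.  (For i = 0
   they are meaningless, and not used.) *)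
Definition opT (i : 'I_n) : 'End(tpow k n) := act_at opR (ord_pred i) i.

Definition swap_word (w : word n) (i j : 'I_n) : word n :=
  [ffun c => w (tperm i j c)].

Definition opS (i : 'I_n) : 'End(tpow k n) :=
  lin_ext (fun w : word n =>
    if w (ord_pred i) == w i then q *: pure k w
    else pure k (swap_word w (ord_pred i) i)).

Definition lambda (a : 'I_2) : k :=
  if a == ord0 then lambda1 q m else lambda2 q m.

(* The condition i = 0 selects the single first tensor factor. *)
Definition opVarpi : 'End(tpow k n) :=
  lin_ext (fun w : word n =>
    (\prod_(i < n | i == 0%N :> nat) lambda (w i)) *: pure k w).

(* theta = S_n ... S_2, leftmost factor applied last. *)
Definition opTheta : 'End(tpow k n) :=
  \big[@comp_lfun _ _ _ _ / \1%VF]_(i <- rev (enum 'I_n) | (0 < i)%N) opS i.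

(* T_1 = T_2^{-1} ... T_n^{-1} theta varpi. *)
Definition opT1 : 'End(tpow k n) :=
  ((\big[@comp_lfun _ _ _ _ / \1%VF]_(i <- enum 'I_n | (0 < i)%N) ((opT i)^-1)%VF)
     \o opTheta \o opVarpi)%VF.

End TensorSpace.

(* Main.v *)
Require Import Defs.
From HB Require Import structures.
From mathcomp Require Import all_boot all_algebra perm zify ring.
From mathcomp.multinomials Require Import monalg.

Set Implicit Arguments.
Unset Strict Implicit.
Unset Printing Implicit Defensive.

Import GRing.Theory.
Local Open Scope ring_scope.

(** A representation of the blob algebra is a choice of operators satisfying its
    five families of relations ([blob_lift]), so everything rests on an explicit
    description of the operators on pure tensors.  A pure tensor is written as
    the word of its indices, in the letters 1 and 2 ([ord0] and [ord_max]).
    Positions are counted from 0, and t_i = [opT i] and s_i = [opS i] act on the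
    positions i - 1 and i.

    For the generators of positive index this is immediate: R - q kills the
    words 11 and 22 and has rank one on the span of 12 and 21.  It is the
    operator [tl], and the Temperley-Lieb relations are a case analysis on at
    most three letters.

    The operator T_1 is given as a product of 2n - 1 factors, and the heart of
    the proof is its closed form.  The inverses of the t_i undo the cyclic
    shift theta up to correction terms: with M_p the product of the inverses
    of the t_i times the product of the s_i, taken over i > p only,
      M_p = 1 - (q - q^-1) E_p,
    where E_p exchanges a letter 1 at position p with a letter 2 further right,
    summed over all such letters 2 with a power of q counting the letters in
    between.  This is proved by descending recursion on p, from the identity
    t_i M_p = M_i s_i for i = p + 1 ([hecke_carry], [carry_prod]).  Consequently
      T_1 - lambda_1 = - [m] P - q^m E_0                      ([opT1_hecke])
    where P projects onto the words with first letter 2.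

    Up to the first letter, which it turns from 1 into 2, E_0 is the action on
    the remaining tensor factors of the raising operator of quantum sl_2, the
    powers of q being those of the iterated coproduct.  This is why it commutes
    with U_i for i >= 2, which acts on these factors by an intertwiner
    ([raise_tl]).  The quadratic relation for U_0 comes from P^2 = P, P E_0 =
    E_0, E_0 P = 0 and E_0^2 = 0 ([blob0_square]); the mixed relation comes from
    U_1 P U_1 = - q U_1, U_1 E_0 U_1 = U_1 and q [m] - q^m = [m - 1]
    ([tl_blob0_tl], [qint_pred]). *)

(** * Representations of the blob algebra *)

Section UniversalProperty.
Variables (k : fieldType) (q : k) (m : int) (n : nat) (A : algType k).
Variable u : 'I_n -> A.

Definition word_eval (s : {fmonom 'I_n}) : A := \prod_(i <- (s : seq 'I_n)) u i.

Lemma word_eval_mmorphism : mmorphism word_eval.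
Proof.
split=> [s t|]; first by rewrite /word_eval fmM big_cat.
by rewrite /word_eval fm1 big_nil.
Qed.

HB.instance Definition _ :=
  isMultiplicative.Build {fmonom 'I_n} A word_eval word_eval_mmorphism.

Definition free_eval (g : free_alg k n) : A := mmap (in_alg A) word_eval g.

Lemma free_evalD : {morph free_eval : g h / g + h}.
Proof. exact: mmapD. Qed.

Lemma free_evalB : {morph free_eval : g h / g - h}.
Proof. exact: mmapB. Qed.

Lemma free_evalZ c : {morph free_eval : g / c *: g}.
Proof. by move=> g; rewrite [LHS]mmapZ /= mulr_algl. Qed.

Lemma free_eval1 : free_eval 1 = 1.
Proof. exact: mmap1. Qed.

(** The target need not be commutative: it suffices that the scalars are central
    in it. *)
Lemma free_evalM : {morph free_eval : x y / x * y}.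
Proof.
apply: (commr_mmap_is_multiplicative (f := in_alg A) _).1 => g s t.
by rewrite /GRing.comm /= mulr_algl mulr_algr.
Qed.

Lemma free_eval_gen i : free_eval (free_gen k i) = u i.
Proof.
rewrite /free_eval /free_gen mmapU /= scale1r mul1r /word_eval fmU.
by rewrite big_seq1.
Qed.

Hypothesis u_braid : forall i j : 'I_n, (0 < i)%N -> (0 < j)%N ->
  (i.+1 == j) || (j.+1 == i) -> u i * u j * u i = u i.
Hypothesis u_square : forall i : 'I_n, (0 < i)%N ->
  u i * u i = - qint q 2 *: u i.
Hypothesis u_square0 : forall i : 'I_n, i = 0%N :> nat ->
  u i * u i = - qint q m *: u i.
Hypothesis u_mixed : forall i j : 'I_n, i = 0%N :> nat -> j = 1%N :> nat ->
  u j * u i * u j = qint q (m - 1) *: u j.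
Hypothesis u_comm : forall i j : 'I_n, (i.+2 <= j)%N || (j.+2 <= i)%N ->
  u i * u j = u j * u i.

Lemma free_eval_relation g h :
  blob_relation q m g h -> free_eval g = free_eval h.
Proof.
case=> [i j i0 j0 ij|i i0|i i0|i j i0 j1|i j ij].
- rewrite [LHS]free_evalM [free_eval (_ * _)]free_evalM !free_eval_gen.
  exact: u_braid.
- by rewrite free_evalZ free_evalM free_eval_gen u_square.
- by rewrite free_evalZ free_evalM free_eval_gen u_square0.
- by rewrite free_evalZ !free_evalM !free_eval_gen u_mixed.
- by rewrite [LHS]free_evalM [RHS]free_evalM !free_eval_gen u_comm.
Qed.

Lemma free_eval_ideal g : in_blob_ideal q m g -> free_eval g = 0.
Proof.
elim=> [|a b l r h /free_eval_relation lr _ IH]; first exact: mmap0.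
by rewrite free_evalD !free_evalM free_evalB lr subrr mulr0 mul0r add0r.
Qed.

(** Evaluation of noncommutative polynomials at the [u i] vanishes on the
    defining ideal, hence descends to the quotient, where it may be computed on
    any representative. *)
Lemma blob_lift : exists rho : blob q m n -> A,
  [/\ linear rho, rho 1 = 1, {morph rho : a b / a * b}
    & forall i, rho (blobU q m i) = u i].
Proof.
pose rho (a : blob q m n) := free_eval (repr a).
have rho_pi g : rho (blob_pi q m g) = free_eval g.
  apply/esym/eqP; rewrite -subr_eq0 -free_evalB; apply/eqP/free_eval_ideal.
  exact/blob_idealP/blob_repr_pi.
exists rho; split=> [c||a b|i].
- elim/blob_pi_ind=> g; elim/blob_pi_ind=> h.
  by rewrite -blob_pi_scale -blob_piD !rho_pi free_evalD free_evalZ.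
- by rewrite -[1]/(blob_pi q m 1) rho_pi free_eval1.
- elim/blob_pi_ind: a => g; elim/blob_pi_ind: b => h.
  by rewrite -blob_pi_mul !rho_pi free_evalM.
- by rewrite rho_pi free_eval_gen.
Qed.

End UniversalProperty.

(** The product is composition in the usual order, so that algebra morphisms to
    [end_algType] are left module structures; [lfun_algType] has the opposite
    product. *)
Section EndomorphismAlgebra.
Variables (k : fieldType) (W : vectType k).
Hypothesis W_proper : (0 < dim W)%N.

Definition end_lalgMixin := GRing.Lmodule_isLalgebra.Build k
  (lfun_comp_nzRingType W_proper) (fun c f g => comp_lfunZl c f g).
Definition end_lalgType : lalgType k :=
  HB.pack 'End(W) (lfun_comp_nzRingType W_proper) end_lalgMixin.
Definition end_algMixin := GRing.Lalgebra_isAlgebra.Build k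
  end_lalgType (fun c f g => comp_lfunZr c f g).
Definition end_algType : algType k := HB.pack 'End(W) end_lalgType end_algMixin.

Lemma end_mulE (f g : end_algType) : f * g = (f \o g)%VF.
Proof. by []. Qed.

End EndomorphismAlgebra.

Lemma tpow_proper (k : fieldType) n : (0 < dim (tpow k n))%N.
Proof.
rewrite lt0n; apply/eqP=> dim0.
have : pure k [ffun=> ord0] = 0 :> tpow k n.
  apply: VectorInternalTheory.v2r_inj.
  do 2!move: (VectorInternalTheory.v2r _); rewrite dim0 => x y.
  by rewrite !thinmx0.
by move/ffunP/(_ [ffun=> ord0])/eqP; rewrite !ffunE eqxx oner_eq0.
Qed.

(** * Pure tensors and words *)

Section PureTensors.
Variables (k : fieldType) (n : nat).

Lemma tpow_pure (t : tpow k n) : t = \sum_(w : word n) (t w : k) *: pure k w.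
Proof.
apply/ffunP=> v; rewrite sum_ffunE (bigD1 v) //= !ffunE eqxx /= [_ *: _]mulr1.
rewrite big1 ?addr0 // => w /negPf wv.
by rewrite !ffunE eq_sym wv [_ *: _]mulr0.
Qed.

Lemma lin_ext_sum (W : vectType k) (g : word n -> W) (t : tpow k n) :
  lin_ext g t = \sum_(w : word n) (t w : k) *: g w.
Proof.
rewrite {1}[t]tpow_pure linear_sum; apply: eq_bigr => w _.
by rewrite linearZ /= lin_extE.
Qed.

Lemma eq_on_pure (W : vectType k) (f g : 'Hom(tpow k n, W)) :
  (forall w, f (pure k w) = g (pure k w)) -> f = g.
Proof.
move=> fg; apply/lfunP=> t; rewrite [t]tpow_pure !linear_sum.
by apply: eq_bigr => w _; rewrite !linearZ /= fg.
Qed.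

End PureTensors.

(** Instances of linearity whose left-hand sides are headed by the application
    of a linear map, so that rewriting with them searches for nothing else. *)
Section LinearMaps.
Variables (k : fieldType) (V W : vectType k) (f : 'Hom(V, W)).

Lemma hom0 : f 0 = 0. Proof. exact: linear0. Qed.
Lemma homN u : f (- u) = - f u. Proof. exact: linearN. Qed.
Lemma homD u v : f (u + v) = f u + f v. Proof. exact: linearD. Qed.
Lemma homB u v : f (u - v) = f u - f v. Proof. exact: linearB. Qed.
Lemma homZ c u : f (c *: u) = c *: f u. Proof. exact: linearZ. Qed.
End LinearMaps.

Section Letters.

Lemma letter0 (a : 'I_2) : (a == ord0) = (a != ord_max).
Proof. by case: a => [[|[|//]] ?]. Qed.

Lemma letterP (a : 'I_2) : a = ord0 \/ a = ord_max.
Proof.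
by case: (eqVneq a ord0) (letter0 a) => [->|_ /esym/negbFE/eqP]; [left|right].
Qed.

Lemma letter_pigeon (a b c : 'I_2) : a != b -> c != a -> c = b.
Proof.
move=> ab ca; apply/val_inj.
by case: a b c ab ca => [[|[|//]] ?] [[|[|//]] ?] [[|[|//]] ?].
Qed.

Lemma swap_wordE n (w : word n) x y c :
  swap_word w x y c = if c == x then w y else if c == y then w x else w c.
Proof.
rewrite ffunE; case: eqP => [->|/eqP cx]; first by rewrite tpermL.
by case: eqP => [->|/eqP cy]; rewrite ?tpermR // tpermD // eq_sym.
Qed.

Lemma swap_wordL n (w : word n) x y : swap_word w x y x = w y.
Proof. by rewrite swap_wordE eqxx. Qed.

Lemma swap_wordR n (w : word n) x y : swap_word w x y y = w x.
Proof. by rewrite ffunE tpermR. Qed.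

Lemma swap_wordD n (w : word n) x y c :
  c != x -> c != y -> swap_word w x y c = w c.
Proof. by move=> /negPf cx /negPf cy; rewrite swap_wordE cx cy. Qed.

Lemma swap_wordC n (w : word n) x y : swap_word w x y = swap_word w y x.
Proof. by apply/ffunP=> c; rewrite !ffunE tpermC. Qed.

Lemma swap_wordK n (w : word n) x y : swap_word (swap_word w x y) x y = w.
Proof. by apply/ffunP=> c; rewrite !ffunE tpermK. Qed.

Lemma swap_word_disjoint n (w : word n) x y z t :
    x != z -> x != t -> y != z -> y != t ->
  swap_word (swap_word w x y) z t = swap_word (swap_word w z t) x y.
Proof.
move=> /eqP xz /eqP xt /eqP yz /eqP yt; apply/ffunP=> c; rewrite !swap_wordE.
by do ?[case: eqP => ? //=]; congruence.
Qed.

End Letters.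

(** * The Temperley-Lieb operators *)

Section TemperleyLieb.
Variables (k : fieldType) (q : k).
Hypothesis q0 : q != 0.

(** The eigenvalue of the Cartan generator K of quantum sl_2 on a basis vector
    of the two-dimensional representation. *)
Definition cartan (a : 'I_2) : k := if a == ord0 then q else q^-1.

Lemma cartan_neq0 a : cartan a != 0.
Proof. by rewrite /cartan; case: ifP; rewrite ?invr_eq0. Qed.

Lemma cartanM a b : a != b -> cartan a * cartan b = 1.
Proof.
rewrite /cartan; case: (eqVneq a ord0) => [->|a0] ab.
  by rewrite eq_sym (negPf ab) mulfV.
case: (eqVneq b ord0) => [_|b0]; first by rewrite mulVf.
by case/eqP: ab; symmetry; apply: letter_pigeon b0; rewrite eq_sym.
Qed.

Lemma cartanV a b : a != b -> (cartan a)^-1 = cartan b.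
Proof.
move=> ab; apply: (mulfI (cartan_neq0 a)).
by rewrite mulfV ?cartan_neq0 // cartanM.
Qed.

Lemma cartanD a b : a != b -> cartan a + cartan b = q + q^-1.
Proof.
move=> ab; rewrite -(cartanV ab) /cartan; case: ifP => _ //.
by rewrite invrK addrC.
Qed.

(* Of the tensor power only this is used: linear maps may be prescribed on the
   basis [e] of pure tensors, and are determined there. *)
Variables (n : nat) (W : vectType k) (e : word n -> W).
Variable ext : (word n -> W) -> 'End(W).
Hypothesis extE : forall g w, ext g (e w) = g w.
Hypothesis eq_on_basis : forall f g : 'End(W),
  (forall w, f (e w) = g (e w)) -> f = g.
Implicit Types (w v : word n) (x y z t p i j l : 'I_n).

(** R - q acting on the tensor factors [x] and [y]: the coefficient
    [cartan (w y)] is q on the word 21 and q^-1 on the word 12. *)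
Definition tl x y : 'End(W) :=
  ext (fun w => if w x == w y then 0
    else e (swap_word w x y) - cartan (w y) *: e w).

Lemma tl_eq x y w : w x = w y -> tl x y (e w) = 0.
Proof. by move=> eq; rewrite extE eq eqxx. Qed.

Lemma tl_neq x y w : w x != w y ->
  tl x y (e w) = e (swap_word w x y) - cartan (w y) *: e w.
Proof. by move=> eq; rewrite extE (negPf eq). Qed.

(** The two words 12 and 21 have proportional images: [tl x y] has rank one on
    the factors [x] and [y].  The quadratic and the braid-like relations reduce
    to this. *)
Lemma tl_swap x y w : w x != w y ->
  tl x y (e (swap_word w x y)) = - cartan (w x) *: tl x y (e w).
Proof.
move=> xy; rewrite !tl_neq ?swap_wordL ?swap_wordR // 1?eq_sym //.
rewrite swap_wordK scalerBr scalerA mulNr cartanM // !scaleNr scale1r opprK.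
by rewrite addrC.
Qed.

Lemma tl_square x y : (tl x y \o tl x y)%VF = - (q + q^-1) *: tl x y.
Proof.
apply: eq_on_basis => w; rewrite comp_lfunE scale_lfunE.
have [eq|eq] := eqVneq (w x) (w y); first by rewrite tl_eq // hom0 scaler0.
rewrite [in LHS](tl_neq eq) homB homZ /= tl_swap // -scalerBl.
by rewrite -(cartanD eq) opprD.
Qed.

Lemma tl_braid x y z : x != y -> y != z -> x != z ->
  (tl x y \o tl y z \o tl x y)%VF = tl x y.
Proof.
move=> xy yz xz; apply: eq_on_basis => w; rewrite !comp_lfunE.
have [eq|eq] := eqVneq (w x) (w y); first by rewrite tl_eq // !hom0.
rewrite [in LHS](tl_neq eq) homB homZ /=.
(* With two letters available, z repeats the letter at x or the one at y, so
   that one of the two terms is killed by [tl y z]. *)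
have [f|f] := eqVneq (w z) (w x).
  have wyz : w y != w z by rewrite f eq_sym.
  have swE : swap_word w x y y = swap_word w x y z.
    by rewrite swap_wordR swap_wordD // eq_sym.
  have zwE : swap_word w y z x = swap_word w y z y.
    by rewrite swap_wordL swap_wordD.
  rewrite (tl_eq swE) sub0r (tl_neq wyz) homN homZ homB homZ /=.
  rewrite (tl_eq zwE) sub0r scalerN opprK scalerA f cartanM ?scale1r //.
  by rewrite eq_sym.
have {}f : w y = w z by symmetry; apply: letter_pigeon f.
have swN : swap_word w x y y != swap_word w x y z.
  by rewrite swap_wordR swap_wordD 1?eq_sym // -f eq_sym.
have szwE :
    swap_word (swap_word w x y) y z x = swap_word (swap_word w x y) y z y.
  by rewrite !(swap_wordL, swap_wordD) // 1?eq_sym // f.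
rewrite (tl_eq f) scaler0 subr0 (tl_neq swN) homB homZ /= (tl_eq szwE).
rewrite sub0r tl_swap // swap_wordD 1?eq_sym // -f.
by rewrite scalerA mulrN scaleNr opprK mulrC cartanM // scale1r.
Qed.

Lemma tl_comm x y z t : x != z -> x != t -> y != z -> y != t ->
  (tl x y \o tl z t)%VF = (tl z t \o tl x y)%VF.
Proof.
move=> xz xt yz yt; apply: eq_on_basis => w; rewrite !comp_lfunE.
have [zx zy tx ty] : [/\ z != x, z != y, t != x & t != y].
  by rewrite ![_ == x]eq_sym ![_ == y]eq_sym.
have [eq|eq] := eqVneq (w z) (w t); have [f|f] := eqVneq (w x) (w y).
- by rewrite !tl_eq ?hom0.
- rewrite (tl_eq eq) hom0 tl_neq // homB homZ /= !tl_eq //.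
    by rewrite scaler0 subr0.
  by rewrite !swap_wordD.
- rewrite (tl_eq f) hom0 tl_neq // homB homZ /= !tl_eq //.
    by rewrite scaler0 subr0.
  by rewrite !swap_wordD.
rewrite (tl_neq eq) (tl_neq f) !homB !homZ /=.
rewrite !tl_neq ?swap_wordD // (swap_word_disjoint _ xz xt yz yt).
rewrite !scalerBr !opprB !scalerA [cartan (w y) * _]mulrC.
by rewrite addrACA [RHS]addrACA; congr (_ + _); rewrite addrC.
Qed.

(** * The raising operator *)

Definition weight (p j : 'I_n) w : k :=
  \prod_(l < n | (p < l < j)%N) cartan (w l).

(** A summand of the iterated coproduct of the raising operator turns the letter
    2 at position [j] into 1; here it is coupled with turning the letter 1 at
    position [p] into 2.  Together this is an exchange of two letters. *)
Definition hop (p j : 'I_n) : 'End(W) :=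
  ext (fun w => if (w p == ord0) && (w j == ord_max)
    then weight p j w *: e (swap_word w p j) else 0).

Lemma hop_in p j w : w p = ord0 -> w j = ord_max ->
  hop p j (e w) = weight p j w *: e (swap_word w p j).
Proof. by move=> p0 j1; rewrite extE p0 j1. Qed.

Lemma hop_out p j w : (w p != ord0) || (w j == ord0) -> hop p j (e w) = 0.
Proof.
move=> out; rewrite extE; case: ifP => // /andP[/eqP p0 /eqP j1].
by rewrite p0 j1 in out.
Qed.

Lemma hop_outl p j w : w p = ord_max -> hop p j (e w) = 0.
Proof. by move=> p1; rewrite hop_out // p1. Qed.

Lemma hop_outr p j w : w j = ord0 -> hop p j (e w) = 0.
Proof. by move=> j0; rewrite hop_out // j0 orbT. Qed.

Lemma weight_perm (s : {perm 'I_n}) p j w v :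
    (forall l, (p < s l < j)%N = (p < l < j)%N) ->
    (forall l, (p < l < j)%N -> v l = w (s l)) ->
  weight p j v = weight p j w.
Proof.
move=> sE vE; rewrite /weight [RHS](reindex_inj (@perm_inj _ s)) /=.
by rewrite [RHS](eq_bigl _ _ sE); apply: eq_bigr => l /vE ->.
Qed.

Lemma weight_eq p j w v :
  (forall l, (p < l < j)%N -> v l = w l) -> weight p j v = weight p j w.
Proof. by move=> vE; apply: eq_bigr => l /vE ->. Qed.

Lemma weight_succ p j w : j = p.+1 :> nat -> weight p j w = 1.
Proof.
by move=> jE; apply: big_pred0 => l; rewrite jE ltnS; case: ltngtP.
Qed.

Lemma weight_first p i j w : i = p.+1 :> nat -> (i < j)%N ->
  weight p j w = cartan (w i) * weight i j w.
Proof.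
move=> iE ij; rewrite /weight (bigD1 i) /=; last by lia.
by congr (_ * _); apply: eq_bigl => l; rewrite -(inj_eq val_inj) /=; lia.
Qed.

Lemma weight_last p x y w : y = x.+1 :> nat -> (p < x)%N ->
  weight p y w = weight p x w * cartan (w x).
Proof.
move=> yE px; rewrite mulrC /weight (bigD1 x) /=; last by lia.
by congr (_ * _); apply: eq_bigl => l; rewrite -(inj_eq val_inj) /=; lia.
Qed.

Lemma ord_ltn_neq x y : (x < y)%N -> x != y /\ y != x.
Proof. by move=> xy; rewrite [y == x]eq_sym neq_ltn xy. Qed.

(** After one hop the letter at position [p] is 2, and no further hop is
    possible. *)
Lemma hop_hop p j l : p != j -> (hop p l \o hop p j)%VF = 0.
Proof.
move=> pj; apply: eq_on_basis => w; rewrite comp_lfunE zero_lfunE.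
case: (letterP (w p)) => p0; last by rewrite (hop_outl _ p0) hom0.
case: (letterP (w j)) => j0; first by rewrite (hop_outr _ j0) hom0.
by rewrite (hop_in p0 j0) homZ hop_outl ?scaler0 // swap_wordL.
Qed.

(** The positions [x] and [y] are adjacent, so they lie on the same side of [j]:
    permuting their letters changes no weight. *)
Lemma tl_hop_disjoint p j x y : y = x.+1 :> nat -> (p < x)%N -> (p < j)%N ->
  j != x -> j != y -> (tl x y \o hop p j)%VF = (hop p j \o tl x y)%VF.
Proof.
move=> yE px pj jx jy; apply: eq_on_basis => w; rewrite !comp_lfunE.
have [p_x x_p] := ord_ltn_neq px.
have [p_y y_p] : p != y /\ y != p by apply: ord_ltn_neq; lia.
have [x_j y_j] : x != j /\ y != j by rewrite ![_ == j]eq_sym.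
have wtE : weight p j (swap_word w x y) = weight p j w.
  apply: (@weight_perm (tperm x y)) => l => [|_]; last by rewrite ffunE.
  move: jx jy; rewrite -!(inj_eq val_inj) /= => jx jy.
  by case: tpermP => [->|->|//]; lia.
case: (boolP ((w p == ord0) && (w j == ord_max))) => [/andP[/eqP p0 /eqP j1]|].
  rewrite (hop_in p0 j1) homZ.
  have [eq|neq] := eqVneq (w x) (w y).
    by rewrite !tl_eq ?hom0 ?scaler0 // !swap_wordD.
  have neq' : swap_word w p j x != swap_word w p j y by rewrite !swap_wordD.
  have p0' : swap_word w x y p = ord0 by rewrite swap_wordD.
  have j1' : swap_word w x y j = ord_max by rewrite swap_wordD.
  rewrite (tl_neq neq) (tl_neq neq') homB homZ (hop_in p0 j1) (hop_in p0' j1').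
  rewrite wtE (swap_word_disjoint _ x_p x_j y_p y_j) swap_wordD //.
  by rewrite scalerBr !scalerA mulrC.
rewrite negb_and -letter0 => out.
rewrite (hop_out out) hom0; have [eq|neq] := eqVneq (w x) (w y).
  by rewrite tl_eq // hom0.
have out' : (swap_word w x y p != ord0) || (swap_word w x y j == ord0).
  by rewrite !swap_wordD.
by rewrite (tl_neq neq) homB homZ (hop_out out) (hop_out out') scaler0 subr0.
Qed.

(** On 11 nothing hops.  On 12 and on 21 only one of the two hops is possible,
    and it leaves equal letters at [x] and [y].  On 22 the two results differ by
    an exchange of the letters at [x] and [y], and their weights by the factor
    that makes the combination vanish under [tl x y]. *)
Lemma tl_hop_pair p x y : y = x.+1 :> nat -> (p < x)%N ->
  (tl x y \o (hop p x + hop p y))%VF = 0.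
Proof.
move=> yE px; apply: eq_on_basis => w.
rewrite comp_lfunE add_lfunE zero_lfunE homD.
have [p_x x_p] := ord_ltn_neq px.
have [p_y y_p] : p != y /\ y != p by apply: ord_ltn_neq; lia.
have [x_y y_x] : x != y /\ y != x by apply: ord_ltn_neq; lia.
case: (letterP (w p)) => p0; last by rewrite !hop_out ?hom0 ?addr0 ?p0.
case: (letterP (w x)) => wx; case: (letterP (w y)) => wy.
- by rewrite !hop_out ?hom0 ?addr0 ?wx ?wy ?eqxx ?orbT.
- rewrite (hop_outr _ wx) (hop_in p0 wy) hom0 homZ tl_eq ?scaler0 ?addr0 //.
  by rewrite swap_wordR swap_wordD // wx.
- rewrite (hop_outr _ wy) (hop_in p0 wx) hom0 homZ tl_eq ?scaler0 ?addr0 //.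
  by rewrite swap_wordR swap_wordD // wy.
rewrite (hop_in p0 wx) (hop_in p0 wy) (weight_last _ yE px) !homZ.
have -> : swap_word w p y = swap_word (swap_word w p x) x y.
  apply/ffunP=> c; rewrite !swap_wordE.
  by do ?[case: eqP => ? //=]; congruence.
rewrite tl_swap ?swap_wordR ?swap_wordD ?p0 ?wy // wx !scalerA -scalerDl.
rewrite -mulrA mulrN cartanM // mulrN1 subrr scale0r //.
Qed.

(** Only words with different letters at [x] and [y] matter.  Both terms of
    [tl x y] lead to the same word, with opposite coefficients. *)
Lemma hop_pair_tl p x y : y = x.+1 :> nat -> (p < x)%N ->
  ((hop p x + hop p y) \o tl x y)%VF = 0.
Proof.
move=> yE px; apply: eq_on_basis => w.
rewrite comp_lfunE zero_lfunE.
have [p_x x_p] := ord_ltn_neq px.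
have [p_y y_p] : p != y /\ y != p by apply: ord_ltn_neq; lia.
have [x_y y_x] : x != y /\ y != x by apply: ord_ltn_neq; lia.
have [eq|neq] := eqVneq (w x) (w y); first by rewrite tl_eq // hom0.
rewrite (tl_neq neq) homB homZ !add_lfunE.
case: (letterP (w p)) => p0; last first.
  have swp1 : swap_word w x y p = ord_max by rewrite swap_wordD.
  by rewrite !(hop_outl _ p0) !(hop_outl _ swp1) addr0 scaler0 subr0.
have swp0 : swap_word w x y p = ord0 by rewrite swap_wordD.
have wtx : weight p x (swap_word w x y) = weight p x w.
  apply: weight_eq => l /andP[_ lx].
  have [lx' _] := ord_ltn_neq lx.
  have [ly _] : l != y /\ y != l by apply: ord_ltn_neq; rewrite yE ltnS ltnW.
  by rewrite swap_wordD.
case: (letterP (w x)) => wx.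
  have wy : w y = ord_max.
    by case: (letterP (w y)) => // wy; rewrite wx wy eqxx in neq.
  have swx : swap_word w x y x = ord_max by rewrite swap_wordL.
  rewrite (hop_in p0 wy) (hop_in swp0 swx).
  have swy : swap_word w x y y = ord0 by rewrite swap_wordR.
  rewrite (hop_outr _ wx) (hop_outr _ swy) addr0 add0r wtx.
  rewrite scalerA (weight_last _ yE px) mulrCA [cartan (w y) * _]mulrC.
  rewrite cartanM // mulr1.
  rewrite (_ : swap_word _ p x = swap_word w p y) ?subrr //.
  apply/ffunP=> c; rewrite !swap_wordE.
  by do ?[case: eqP => ? //=]; congruence.
have wy : w y = ord0.
  by case: (letterP (w y)) => // wy; rewrite wx wy eqxx in neq.
have swy : swap_word w x y y = ord_max by rewrite swap_wordR.
rewrite (hop_in p0 wx) (hop_in swp0 swy).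
have swx : swap_word w x y x = ord0 by rewrite swap_wordL.
rewrite (hop_outr _ wy) (hop_outr _ swx) addr0 add0r.
rewrite (weight_last _ yE px) wtx swap_wordL scalerA wy mulrC.
rewrite (_ : swap_word _ p y = swap_word w p x) ?subrr //.
apply/ffunP=> c; rewrite !swap_wordE.
by do ?[case: eqP => ? //=]; congruence.
Qed.

Definition raise p : 'End(W) := \sum_(j < n | (p < j)%N) hop p j.

Lemma comp_lfun_sumr (I : finType) (P : pred I) (f : 'End(W))
    (g : I -> 'End(W)) :
  (f \o \sum_(i | P i) g i)%VF = \sum_(i | P i) (f \o g i)%VF.
Proof.
apply: (big_morph (fun h : 'End(W) => (f \o h)%VF)) => [g1 g2|].
  exact: comp_lfunDr.
exact: comp_lfun0r.
Qed.

Lemma comp_lfun_suml (I : finType) (P : pred I) (f : 'End(W))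
    (g : I -> 'End(W)) :
  ((\sum_(i | P i) g i) \o f)%VF = \sum_(i | P i) (g i \o f)%VF.
Proof.
apply: (big_morph (fun h : 'End(W) => (h \o f)%VF)) => [g1 g2|].
  exact: comp_lfunDl.
exact: comp_lfun0l.
Qed.

Lemma raise_square p : (raise p \o raise p)%VF = 0.
Proof.
rewrite /raise comp_lfun_sumr big1 // => j pj.
rewrite comp_lfun_suml big1 // => l _; apply: hop_hop.
by have [] := ord_ltn_neq pj.
Qed.

(** Intertwining: the hops from [x] and [y] together give 0 on both sides, and
    each of the others commutes with [tl x y]. *)
Lemma raise_tl p x y : y = x.+1 :> nat -> (p < x)%N ->
  (tl x y \o raise p)%VF = (raise p \o tl x y)%VF.
Proof.
move=> yE px; rewrite /raise.
have yx : y != x by have [|] := @ord_ltn_neq x y; rewrite ?yE.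
have py : (p < y)%N by rewrite yE ltnS ltnW.
rewrite (bigD1 x) //= (bigD1 y) /=; last by rewrite py yx.
rewrite addrA comp_lfunDr comp_lfunDl tl_hop_pair // hop_pair_tl // !add0r.
rewrite comp_lfun_sumr comp_lfun_suml.
apply: eq_bigr => j /andP[/andP[pj jx] jy].
exact: tl_hop_disjoint.
Qed.

Definition proj_max p : 'End(W) :=
  ext (fun w => if w p == ord0 then 0 else e w).

Lemma proj_max0 p w : w p = ord0 -> proj_max p (e w) = 0.
Proof. by move=> p0; rewrite extE p0. Qed.

Lemma proj_max1 p w : w p = ord_max -> proj_max p (e w) = e w.
Proof. by move=> p1; rewrite extE p1. Qed.

Lemma proj_max_idem p : (proj_max p \o proj_max p)%VF = proj_max p.
Proof.
apply: eq_on_basis => w; rewrite comp_lfunE.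
by case: (letterP (w p)) => p0; rewrite ?(proj_max0 p0) ?hom0 ?(proj_max1 p0).
Qed.

Lemma proj_max_tl p x y : p != x -> p != y ->
  (tl x y \o proj_max p)%VF = (proj_max p \o tl x y)%VF.
Proof.
move=> px py; apply: eq_on_basis => w; rewrite !comp_lfunE.
have [eq|neq] := eqVneq (w x) (w y).
  rewrite [tl x y (e w)]tl_eq // hom0.
  case: (letterP (w p)) => p0; first by rewrite (proj_max0 p0) hom0.
  by rewrite (proj_max1 p0) tl_eq.
have sp : swap_word w x y p = w p by rewrite swap_wordD.
rewrite (tl_neq neq) homB homZ; case: (letterP (w p)) => p0; rewrite p0 in sp.
  by rewrite !proj_max0 // hom0 scaler0 subr0.
by rewrite !proj_max1 // tl_neq.
Qed.

Lemma proj_max_hop p j : p != j -> (proj_max p \o hop p j)%VF = hop p j.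
Proof.
move=> pj; apply: eq_on_basis => w; rewrite comp_lfunE.
case: (letterP (w p)) => p0; last by rewrite (hop_outl _ p0) hom0.
case: (letterP (w j)) => j1; first by rewrite (hop_outr _ j1) hom0.
by rewrite (hop_in p0 j1) homZ proj_max1 // swap_wordL.
Qed.

Lemma hop_proj_max p j : (hop p j \o proj_max p)%VF = 0.
Proof.
apply: eq_on_basis => w; rewrite comp_lfunE zero_lfunE.
case: (letterP (w p)) => p0; first by rewrite (proj_max0 p0) hom0.
by rewrite (proj_max1 p0) (hop_outl _ p0).
Qed.

Lemma proj_max_raise p : (proj_max p \o raise p)%VF = raise p.
Proof.
rewrite /raise comp_lfun_sumr; apply: eq_bigr => j /ord_ltn_neq[pj _].
exact: proj_max_hop.
Qed.

Lemma raise_proj_max p : (raise p \o proj_max p)%VF = 0.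
Proof.
by rewrite /raise comp_lfun_suml big1 // => j _; apply: hop_proj_max.
Qed.

(** By rank one, the left-hand side is a multiple of [tl p y]; the factor can be
    read off on a word with 12 at [p] and [y]. *)
Lemma tl_proj_max_tl p y : p != y ->
  (tl p y \o proj_max p \o tl p y)%VF = - q *: tl p y.
Proof.
move=> py; apply: eq_on_basis => w; rewrite !comp_lfunE scale_lfunE.
have [eq|neq] := eqVneq (w p) (w y).
  by rewrite [tl p y (e w)]tl_eq // !hom0 scaler0.
rewrite {1}(tl_neq neq) homB homZ.
case: (letterP (w p)) => p0.
  have y1 : w y = ord_max.
    by case: (letterP (w y)) => // y0; rewrite p0 y0 eqxx in neq.
  have sp : swap_word w p y p = ord_max by rewrite swap_wordL.
  rewrite (proj_max0 p0) (proj_max1 sp) scaler0 subr0 tl_swap // p0.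
  by rewrite /cartan eqxx.
have y0 : w y = ord0.
  by case: (letterP (w y)) => // y0; rewrite p0 y0 eqxx in neq.
have sp : swap_word w p y p = ord0 by rewrite swap_wordL.
rewrite (proj_max0 sp) (proj_max1 p0) sub0r homN homZ y0.
by rewrite /cartan eqxx scaleNr.
Qed.

(** A hop starting from 1 at [p] leaves a letter 2 there; as [w y] was different
    from 1, the two letters are now equal. *)
Lemma tl_hop_neq p y j w : y = p.+1 :> nat -> (y < j)%N -> w p != w y ->
  tl p y (hop p j (e w)) = 0.
Proof.
move=> yE yj neq; have [y_j j_y] := ord_ltn_neq yj.
have [y_p p_y] : y != p /\ p != y.
  by have [] := @ord_ltn_neq p y; rewrite ?yE.
case: (letterP (w p)) => p0; last by rewrite (hop_outl _ p0) hom0.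
case: (letterP (w j)) => j1; first by rewrite (hop_outr _ j1) hom0.
have y1 : w y = ord_max.
  by case: (letterP (w y)) => // y0; rewrite p0 y0 eqxx in neq.
rewrite (hop_in p0 j1) homZ tl_eq ?scaler0 //.
by rewrite swap_wordL swap_wordD // j1.
Qed.

Lemma tl_hop_far_tl p y j : y = p.+1 :> nat -> (y < j)%N ->
  (tl p y \o hop p j \o tl p y)%VF = 0.
Proof.
move=> yE yj; apply: eq_on_basis => w; rewrite !comp_lfunE zero_lfunE.
have [eq|neq] := eqVneq (w p) (w y).
  by rewrite [tl p y (e w)]tl_eq // !hom0.
rewrite [in X in tl p y X](tl_neq neq) !(homB, homZ) !tl_hop_neq //.
  by rewrite scaler0 subr0.
by rewrite swap_wordL swap_wordR eq_sym.
Qed.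

Lemma tl_hop_near_tl p y : y = p.+1 :> nat ->
  (tl p y \o hop p y \o tl p y)%VF = tl p y.
Proof.
move=> yE; apply: eq_on_basis => w; rewrite !comp_lfunE.
have [eq|neq] := eqVneq (w p) (w y).
  by rewrite [tl p y (e w)]tl_eq // !hom0.
rewrite {1}(tl_neq neq) homB homZ.
case: (letterP (w p)) => p0.
  have y1 : w y = ord_max.
    by case: (letterP (w y)) => // y0; rewrite p0 y0 eqxx in neq.
  have sp : swap_word w p y p = ord_max by rewrite swap_wordL.
  rewrite (hop_outl _ sp) (hop_in p0 y1) weight_succ // scale1r sub0r homN homZ.
  by rewrite tl_swap // scalerA mulrN scaleNr opprK mulrC cartanM // scale1r.
have y0 : w y = ord0.
  by case: (letterP (w y)) => // y0; rewrite p0 y0 eqxx in neq.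
have sp : swap_word w p y p = ord0 by rewrite swap_wordL.
have sy : swap_word w p y y = ord_max by rewrite swap_wordR.
rewrite (hop_outl _ p0) scaler0 subr0 (hop_in sp sy) weight_succ // scale1r.
by rewrite swap_wordK.
Qed.

Lemma tl_raise_tl p y : y = p.+1 :> nat ->
  (tl p y \o raise p \o tl p y)%VF = tl p y.
Proof.
move=> yE; rewrite /raise (bigD1 y) /=; last by rewrite yE.
rewrite comp_lfunDr comp_lfunDl tl_hop_near_tl // comp_lfun_sumr comp_lfun_suml.
rewrite big1 ?addr0 // => j /andP[pj jy]; apply: tl_hop_far_tl => //.
by rewrite ltn_neqAle eq_sym jy yE.
Qed.

(** * The closed form of T_1 *)

Definition hecke x y : 'End(W) := q *: \1%VF + tl x y.

(** The operator [opS], when [x] and [y] are adjacent positions. *)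
Definition qswap x y : 'End(W) :=
  ext (fun w => if w x == w y then q *: e w else e (swap_word w x y)).

Lemma heckeE x y u : hecke x y u = q *: u + tl x y u.
Proof. by rewrite add_lfunE scale_lfunE id_lfunE. Qed.

(** On the kernel [tl x y] acts by - q, which is not a root of
    X^2 + (q + q^-1) X. *)
Lemma hecke_inj x y : lker (hecke x y) == 0%VS.
Proof.
apply/lker0P => u v /eqP; rewrite -subr_eq0 -homB heckeE => /eqP.
set z := u - v => /eqP; rewrite addrC addr_eq0 => /eqP tz.
have : tl x y (tl x y z) + (q + q^-1) *: tl x y z = 0.
  by rewrite -comp_lfunE tl_square scale_lfunE scaleNr addNr.
rewrite tz homN homZ tz !scalerN opprK !scalerA -scalerBl mulrDl mulVf //.
rewrite opprD addrA subrr sub0r scaleN1r => /eqP.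
by rewrite oppr_eq0 subr_eq0 => /eqP.
Qed.

(** A hop from [p] over [i] becomes a hop from [i]: if the letter at [i] is 1,
    the hop makes the pair 21, which [hecke] exchanges; if it is 2, the hop
    makes the pair 22, which [hecke] multiplies by q, whereas [qswap] moves the
    letter 1 from [p] to [i].  The factor q or q^-1 of the letter at [i] in the
    weight accounts for the difference. *)
Lemma hecke_hop p i j : i = p.+1 :> nat -> (i < j)%N ->
  (hecke p i \o hop p j)%VF = (hop i j \o qswap p i)%VF.
Proof.
move=> iE ij; apply: eq_on_basis => w; rewrite !comp_lfunE [qswap _ _ _]extE.
have [i_j j_i] := ord_ltn_neq ij.
have [p_i i_p] : p != i /\ i != p by apply: ord_ltn_neq; rewrite iE.
have [p_j j_p] : p != j /\ j != p.
  by apply: ord_ltn_neq; rewrite (ltn_trans _ ij) // iE.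
case: (letterP (w j)) => j1.
  have sj : swap_word w p i j = ord0 by rewrite swap_wordD.
  rewrite (hop_outr _ j1) hom0; case: ifP => _; rewrite ?homZ.
    by rewrite (hop_outr _ j1) scaler0.
  by rewrite (hop_outr _ sj).
case: (letterP (w p)) => p0; case: (letterP (w i)) => i0.
- rewrite p0 i0 eqxx (hop_in p0 j1) !homZ (hop_in i0 j1) heckeE.
  rewrite tl_neq ?swap_wordL ?swap_wordD // ?j1 ?i0 //.
  rewrite addrCA /cartan eqxx subrr addr0 scalerA (weight_first _ iE ij) i0.
  rewrite /cartan eqxx.
  congr (_ *: e _); apply/ffunP=> c; rewrite !swap_wordE.
  by do ?[case: eqP => ? //=]; congruence.
- rewrite p0 i0 (hop_in p0 j1) homZ heckeE tl_eq ?addr0; last first.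
    by rewrite swap_wordL swap_wordD // j1.
  have si : swap_word w p i i = ord0 by rewrite swap_wordR.
  have sj : swap_word w p i j = ord_max by rewrite swap_wordD.
  rewrite (hop_in si sj) (weight_first _ iE ij) i0 scalerA mulrAC.
  rewrite /cartan /= mulVf // mul1r.
  rewrite (@weight_eq i j w (swap_word w p i)); last first.
    move=> l /andP[il _]; have [_ li] := ord_ltn_neq il.
    have [_ lp] : p != l /\ l != p.
      by apply: ord_ltn_neq; rewrite (ltn_trans _ il) // iE.
    by rewrite swap_wordD.
  congr (_ *: e _); apply/ffunP=> c; rewrite !swap_wordE.
  by do ?[case: eqP => ? //=]; congruence.
- have si : swap_word w p i i = ord_max by rewrite swap_wordR.
  by rewrite (hop_outl _ p0) hom0 p0 i0 (hop_outl _ si).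
by rewrite (hop_outl _ p0) hom0 p0 i0 eqxx homZ (hop_outl _ i0) scaler0.
Qed.

(** The hop sends the word 12 to 21, which [hecke] sends back to 12; this
    removes the diagonal term of [hecke] on 12.  On the other words the hop
    vanishes, and [hecke] and [qswap] agree. *)
Lemma hecke_hop_next p i : i = p.+1 :> nat ->
  (hecke p i \o (\1 - (q - q^-1) *: hop p i))%VF = qswap p i.
Proof.
move=> iE; apply: eq_on_basis => w.
have subE : (\1 - (q - q^-1) *: hop p i)%VF (e w) =
    e w - (q - q^-1) *: hop p i (e w).
  by rewrite add_lfunE opp_lfunE scale_lfunE id_lfunE.
rewrite comp_lfunE subE [qswap _ _ _]extE homB homZ.
case: (letterP (w p)) => p0; case: (letterP (w i)) => i0.
- by rewrite (hop_outr _ i0) hom0 scaler0 subr0 heckeE tl_eq p0 i0 // addr0.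
- have neq : w p != w i by rewrite p0 i0.
  have swapE : hecke p i (e (swap_word w p i)) = e w.
    rewrite heckeE tl_swap // (tl_neq neq) p0 i0 /cartan /=.
    rewrite scaleNr scalerBr scalerA mulfV // scale1r opprB.
    by rewrite addrCA subrr addr0.
  rewrite (hop_in p0 i0) weight_succ // scale1r swapE heckeE (tl_neq neq).
  by rewrite (negPf neq) i0 /cartan /= addrCA -scalerBl addrK.
- have neq : w p != w i by rewrite p0 i0.
  rewrite (hop_outr _ i0) hom0 scaler0 subr0 heckeE (tl_neq neq) (negPf neq) i0.
  by rewrite /cartan eqxx addrC subrK.
by rewrite (hop_outl _ p0) hom0 scaler0 subr0 heckeE tl_eq p0 i0 // addr0.
Qed.

(** What remains when the letter at [p] is carried to the end of the word by
    [qswap] and back by the inverses of [hecke], see [carry_prod]. *)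
Definition carry p : 'End(W) := \1%VF - (q - q^-1) *: raise p.

Lemma hecke_carry p i : i = p.+1 :> nat ->
  (hecke p i \o carry p)%VF = (carry i \o qswap p i)%VF.
Proof.
move=> iE; rewrite /carry /raise (bigD1 i) /=; last by rewrite iE.
rewrite scalerDr opprD addrA comp_lfunDr hecke_hop_next //.
rewrite [RHS]comp_lfunDl comp_lfun1l comp_lfunNl comp_lfunNr; congr (_ - _).
rewrite -comp_lfunZr -comp_lfunZl comp_lfun_sumr comp_lfun_suml; congr (_ *: _).
have ltE j : (p < j)%N && (j != i) = (i < j)%N.
  by rewrite -(inj_eq val_inj) /=; lia.
by rewrite (eq_bigl _ _ ltE); apply: eq_bigr => j ij; apply: hecke_hop.
Qed.

(** * The relations of U_0 *)

Section Blob.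
Variables (a b : k).

Definition blob0 p : 'End(W) := a *: proj_max p + b *: raise p.

Lemma blob0_square p : (blob0 p \o blob0 p)%VF = a *: blob0 p.
Proof.
rewrite /blob0 comp_lfunDl !comp_lfunDr -!comp_lfunZl -!comp_lfunZr.
rewrite proj_max_idem proj_max_raise raise_proj_max raise_square.
by rewrite !scaler0 !addr0 scalerDr.
Qed.

Lemma blob0_tl p x y : y = x.+1 :> nat -> (p < x)%N ->
  (tl x y \o blob0 p)%VF = (blob0 p \o tl x y)%VF.
Proof.
move=> yE px; have [p_x _] := ord_ltn_neq px.
have [p_y _] : p != y /\ y != p by apply: ord_ltn_neq; rewrite yE ltnS ltnW.
rewrite /blob0 comp_lfunDl comp_lfunDr -!comp_lfunZl -!comp_lfunZr.
by rewrite proj_max_tl // raise_tl.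
Qed.

(** With [a] the negative of [qint q m] and [b] that of [q ^ m], the factor is
    [qint q (m - 1)], see [qint_pred]. *)
Lemma tl_blob0_tl p y : y = p.+1 :> nat ->
  (tl p y \o blob0 p \o tl p y)%VF = (b - q * a) *: tl p y.
Proof.
move=> yE; have [p_y _] : p != y /\ y != p by apply: ord_ltn_neq; rewrite yE.
rewrite /blob0 comp_lfunDr comp_lfunDl -!comp_lfunZr -!comp_lfunZl.
rewrite tl_proj_max_tl // tl_raise_tl // scalerA -scalerDl.
by rewrite addrC mulrN [a * q]mulrC.
Qed.
End Blob.

End TemperleyLieb.

(** * Ordered products over positions *)

Section Positions.
Variable n : nat.
Implicit Types i p : 'I_n.

Lemma ord_pred_succ i : (0 < i)%N -> i = (ord_pred i).+1 :> nat.
Proof.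
case: n i => [[]//|n'] i i0 /=.
by rewrite -subn1 -addnBAC // modnDr modn_small; have := ltn_ord i; lia.
Qed.

(** Peels off the outermost factor of the products over positions beyond [p]. *)
Lemma enum_gt p i : i = p.+1 :> nat ->
  [seq l : 'I_n <- enum 'I_n | (p < l)%N] =
  i :: [seq l : 'I_n <- enum 'I_n | (i < l)%N].
Proof.
move=> iE; pose lt := relpre (@nat_of_ord n) ltn.
have lt_trans : transitive lt by move=> ? ? ?; apply: ltn_trans.
have lt_irr : irreflexive lt by move=> l; apply: ltnn.
have enum_sorted : sorted lt (enum 'I_n).
  by rewrite -sorted_map val_enum_ord iota_ltn_sorted.
apply: (irr_sorted_eq lt_trans lt_irr) => [||l].
- exact: sorted_filter.
- by rewrite /= path_sortedE // filter_all sorted_filter.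
have memE (r : 'I_n) :
    (l \in [seq l : 'I_n <- enum 'I_n | (r < l)%N]) = (r < l)%N.
  by rewrite mem_filter mem_enum andbT.
by rewrite inE !memE iE -(inj_eq val_inj) /=; lia.
Qed.

End Positions.

HB.instance Definition _ (k : fieldType) (W : vectType k) :=
  Monoid.isLaw.Build 'End(W) \1%VF (@comp_lfun k W W W)
    (@comp_lfunA k W W W W) (@comp_lfun1l k W W) (@comp_lfun1r k W W).

(** * The module *)

Section WordModule.
Variables (k : fieldType) (q : k) (n : nat).
Hypothesis q0 : q != 0.
Variables (W : vectType k) (e : word n.+1 -> W).
Variable ext : (word n.+1 -> W) -> 'End(W).
Hypothesis extE : forall g w, ext g (e w) = g w.
Hypothesis eq_on_basis : forall f g : 'End(W),
  (forall w, f (e w) = g (e w)) -> f = g.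

(** Reading the tensor factors from right to left replaces q by its inverse. *)
Lemma tl_reverse x y : tl q e ext x y = tl q^-1 e ext y x.
Proof.
apply: eq_on_basis => w; have [eq|neq] := eqVneq (w x) (w y).
  by rewrite !tl_eq.
rewrite !tl_neq // 1?eq_sym // swap_wordC; congr (_ - _ *: _).
by rewrite -(cartanV q0 neq) /cartan; case: ifP; rewrite ?invrK.
Qed.

Local Notation tl := (tl q e ext).
Local Notation hecke := (hecke q e ext).
Local Notation qswap := (qswap q e ext).
Local Notation carry := (carry q e ext).
Local Notation raise := (raise q e ext).
Implicit Types (i j p : 'I_n.+1) (w : word n.+1).

Lemma tl_braid_rev x y z : x != y -> y != z -> x != z ->
  (tl y z \o tl x y \o tl y z)%VF = tl y z.
Proof.
move=> xy yz xz; rewrite !tl_reverse; apply: tl_braid => //.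
  by rewrite invr_eq0.
all: by rewrite eq_sym.
Qed.

(** Descending recursion on [p].  For the last position both products are empty.
    Otherwise the new factors are the leftmost inverse and the rightmost swap,
    and [hecke_carry] moves the new swap through. *)
Lemma carry_prod p :
  (\big[@comp_lfun _ _ _ _ / \1%VF]_(i <- enum 'I_n.+1 | (p < i)%N)
      (hecke (ord_pred i) i)^-1 \o
   \big[@comp_lfun _ _ _ _ / \1%VF]_(i <- rev (enum 'I_n.+1) | (p < i)%N)
      qswap (ord_pred i) i)%VF = carry p.
Proof.
rewrite -[in LHS]big_filter -[X in (_ \o X)%VF]big_filter filter_rev.
have [d] := ubnP (n - p); elim: d => // d IH in p *; rewrite ltnS => pd.
have [np|pn] := leqP n p.
  have none i : (p < i)%N = false by have := ltn_ord i; lia.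
  rewrite (eq_filter none) filter_pred0 !big_nil comp_lfun1l /carry /raise.
  by rewrite big_pred0 // scaler0 subr0.
have [i iE] : exists i : 'I_n.+1, i = p.+1 :> nat.
  by exists (Ordinal (pn : p.+1 < n.+1)%N).
have pE : ord_pred i = p.
  have i0 : (0 < i)%N by rewrite iE.
  by apply: val_inj; have := ord_pred_succ i0; rewrite iE => -[].
rewrite (enum_gt iE) rev_cons big_cons -cats1 big_cat big_seq1 /= pE.
rewrite -comp_lfunA [X in (_ \o X)%VF]comp_lfunA IH; last by rewrite iE; lia.
by rewrite -hecke_carry // lker0_compKf // hecke_inj.
Qed.

(** On words with first letter 2, [carry ord0] is the identity; on the others
    the scalar [l1] cancels and only the raising operator is left. *)
Lemma carry_first_weight (l1 l2 : k) :
  (carry ord0 \o ext (fun w => (if w ord0 == ord0 then l1 else l2) *: e w))%VF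
    - l1 *: \1%VF =
  blob0 q e ext (l2 - l1) (- (q - q^-1) * l1) ord0.
Proof.
apply: eq_on_basis => w.
rewrite [LHS]add_lfunE opp_lfunE scale_lfunE id_lfunE comp_lfunE extE.
rewrite [RHS]add_lfunE !scale_lfunE homZ.
have -> : carry ord0 (e w) = e w - (q - q^-1) *: raise ord0 (e w).
  by rewrite [LHS]add_lfunE opp_lfunE scale_lfunE id_lfunE.
case: (letterP (w ord0)) => w0; rewrite w0 /=.
  rewrite (proj_max0 _ w0) // scaler0 add0r scalerBr scalerA addrAC subrr add0r.
  by rewrite mulNr scaleNr mulrC.
have -> : raise ord0 (e w) = 0.
  rewrite -{1}(proj_max1 extE w0) -comp_lfunE.
  by rewrite (raise_proj_max q extE eq_on_basis) zero_lfunE.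
by rewrite (proj_max1 extE w0) !scaler0 subr0 addr0 scalerBl.
Qed.

Variable m : int.
Hypothesis q2 : q - q^-1 != 0.
Hypothesis W_proper : (0 < dim W)%N.

Definition blob_gen (i : 'I_n.+1) : end_algType W_proper :=
  if (i == 0 :> nat)%N then blob0 q e ext (- qint q m) (- q ^ m) ord0
  else tl (ord_pred i) i.

Lemma qint2 : qint q 2 = q + q^-1.
Proof.
rewrite /qint -[q ^ 2]/(q ^+ 2) -[q ^ (- 2)]/(q ^- 2).
have -> : q ^+ 2 - q ^- 2 = (q + q^-1) * (q - q^-1).
  by rewrite -exprVn subr_sqr mulrC.
by rewrite mulfK.
Qed.

Lemma qint_pred : - q ^ m - q * (- qint q m) = qint q (m - 1).
Proof.
rewrite /qint opprB !expfzDr // -[q ^ (-1)]/q^-1 expr1z -invr_expz.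
have qm0 : q ^ m != 0 by rewrite expfz_neq0.
by field; rewrite q0 qm0 !andbT -(mulfV q0) -mulrBr mulf_neq0.
Qed.

Lemma blob_module : exists rho : blob q m n.+1 -> 'End(W),
  is_module_structure rho /\
  forall i, rho (blobU q m i) = blob_gen i.
Proof.
have gen_pos i : (0 < i)%N -> blob_gen i = tl (ord_pred i) i.
  by move=> i0; rewrite /blob_gen; case: ifP => // /eqP i1; rewrite i1 in i0.
have gen0 i : i = 0%N :> nat ->
    blob_gen i = blob0 q e ext (- qint q m) (- q ^ m) ord0.
  by rewrite /blob_gen => ->.
have [] := @blob_lift k q m n.+1 (end_algType W_proper) blob_gen.
- move=> i j i0 j0 ij; rewrite !end_mulE !gen_pos //.
  have iP := ord_pred_succ i0; have jP := ord_pred_succ j0.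
  have [iI _] : ord_pred i != i /\ i != ord_pred i.
    by apply: ord_ltn_neq; rewrite [ltnRHS]iP.
  have [jI _] : ord_pred j != j /\ j != ord_pred j.
    by apply: ord_ltn_neq; rewrite [ltnRHS]jP.
  case/orP: ij => /eqP ij.
    have -> : ord_pred j = i by apply: val_inj; apply: eq_add_S; rewrite -jP ij.
    apply: tl_braid => //.
      by have [] := @ord_ltn_neq _ i j; rewrite -?ij.
    have [] := @ord_ltn_neq _ (ord_pred i) j; rewrite -?ij //.
    by rewrite ltnS [leqRHS]iP.
  have -> : ord_pred i = j by apply: val_inj; apply: eq_add_S; rewrite -iP ij.
  apply: tl_braid_rev => //.
    by have [] := @ord_ltn_neq _ j i; rewrite -?ij.
  have [] := @ord_ltn_neq _ (ord_pred j) i; rewrite -?ij //.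
  by rewrite ltnS [leqRHS]jP.
- by move=> i i0; rewrite end_mulE gen_pos // tl_square // qint2.
- by move=> i i0; rewrite end_mulE gen0 // blob0_square.
- move=> i j i0 j1; rewrite !end_mulE (gen0 i i0) gen_pos ?j1 //.
  have -> : ord_pred j = ord0.
    by apply: val_inj; apply: eq_add_S; rewrite -ord_pred_succ j1.
  by rewrite tl_blob0_tl // qint_pred.
- have comm i j : (i.+2 <= j)%N ->
      blob_gen i * blob_gen j = blob_gen j * blob_gen i.
    move=> ij; rewrite !end_mulE (gen_pos j) //; last exact: leq_trans ij.
    have j0 : (0 < j)%N by apply: leq_trans ij.
    have := ord_pred_succ j0; move: (ord_pred j) => z jP.
    have [i0|i0] := posnP i.
      by rewrite gen0 //; symmetry; apply: blob0_tl => //; rewrite /=; lia.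
    rewrite gen_pos //; have := ord_pred_succ i0; move: (ord_pred i) => x iP.
    have [x_z _] : x != z /\ z != x by apply: ord_ltn_neq; lia.
    have [x_j _] : x != j /\ j != x by apply: ord_ltn_neq; lia.
    have [i_z _] : i != z /\ z != i by apply: ord_ltn_neq; lia.
    have [i_j _] : i != j /\ j != i by apply: ord_ltn_neq; lia.
    exact: tl_comm.
  by move=> i j /orP[/comm|/comm/esym].
move=> rho [rho_lin rho1 rhoM rhoU].
exists rho; split; last exact: rhoU.
by split.
Qed.

End WordModule.

(** * Comparison with the operators on the tensor power *)

Section TensorSpaceOperators.
Variables (k : fieldType) (q : k) (n : nat).

Lemma opT_hecke (i : 'I_n) : (0 < i)%N ->
  opT q i = hecke q (@pure k n) (@lin_ext k n _) (ord_pred i) i.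
Proof.
move=> i0; apply: eq_on_pure => w.
rewrite heckeE /opT /act_at lin_extE.
rewrite -(lin_ext_sum (fun u => pure k (subst_word w (ord_pred i) i u))).
set x := ord_pred i; pose a := w x; pose b := w i.
have swapE : subst_word w x i (pair_word b a) = swap_word w x i.
  by apply/ffunP=> c; rewrite swap_wordE !ffunE.
have idE : subst_word w x i (pair_word a b) = w.
  by apply/ffunP=> c; rewrite !ffunE; do ?[case: eqP => [->//=|_]].
rewrite lin_extE /= !ffunE /= -/a -/b.
have [ab|ab] := eqVneq a b.
  by rewrite homZ /= lin_extE {2}ab idE (tl_eq _ (@lin_extE k n _)) ?addr0.
rewrite (tl_neq _ (@lin_extE k n _)) // -/b.
case: ifP => [/andP[/eqP a1 /eqP b0]|ab'].
  by rewrite lin_extE swapE /cartan b0 eqxx addrC subrK.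
have b0 : b == ord0 = false.
  apply/negP=> /eqP b0; move: ab'; rewrite b0 eqxx andbT => /negbT.
  by rewrite -letter0 -b0 (negPf ab).
rewrite homD homZ /= !lin_extE swapE idE /cartan b0.
by rewrite scalerBl [q *: _ + _]addrC addrAC addrA.
Qed.

End TensorSpaceOperators.

Lemma opT1_hecke (k : fieldType) (q : k) (m : int) (n : nat) :
  q != 0 -> q - q^-1 != 0 ->
  opT1 q m n.+1 - lambda1 q m *: \1%VF =
  blob0 q (@pure k n.+1) (@lin_ext k n.+1 _) (- qint q m) (- q ^ m) ord0.
Proof.
move=> q0 q2.
have -> : - qint q m = lambda2 q m - lambda1 q m.
  by rewrite -mulrBl -mulNr opprB.
have -> : - q ^ m = - (q - q^-1) * lambda1 q m by rewrite mulNr mulrC divfK.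
have varpiE : opVarpi q m n.+1 = lin_ext (fun w : word n.+1 =>
    (if w ord0 == ord0 then lambda1 q m else lambda2 q m) *: pure k w).
  by apply: eq_on_pure => w; rewrite !lin_extE (big_pred1 ord0).
have prodE :
    \big[@comp_lfun _ _ _ _ / \1%VF]_(i <- enum 'I_n.+1 | (0 < i)%N)
      ((opT q i)^-1)%VF =
    \big[@comp_lfun _ _ _ _ / \1%VF]_(i <- enum 'I_n.+1 | (0 < i)%N)
      ((hecke q (@pure k n.+1) (@lin_ext k n.+1 _) (ord_pred i) i)^-1)%VF.
  by apply: eq_bigr => i i0; rewrite opT_hecke.
rewrite -(carry_first_weight q (@lin_extE k n.+1 _) (@eq_on_pure k n.+1 _)).
rewrite -(carry_prod q0 (@lin_extE k n.+1 _) (@eq_on_pure k n.+1 _)).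
by rewrite /opT1 prodE varpiE.
Qed.

Theorem corollary1 (k : closedFieldType) (q : k) (m : int) (n : nat)
  (q_neq0 : q != 0)
  (q4_neq1 : q ^+ 4 != 1)
  (lambda_neq : lambda1 q m != lambda2 q m)
  (lambda_neq_q2 : lambda1 q m != q ^+ 2 * lambda2 q m)
  (n_ge1 : (1 <= n)%N) :
  exists rho : blob q m n -> 'End(tpow k n),
    [/\ is_module_structure rho,
        forall i : 'I_n, (1 <= i)%N ->
          rho (blobU q m i) = opT q i - q *: \1%VF
      & forall i : 'I_n, i = 0%N :> nat ->
          rho (blobU q m i) = opT1 q m n - lambda1 q m *: \1%VF].
Proof.
have q2 : q - q^-1 != 0.
  apply: contraNneq q4_neq1 => /subr0_eq qV.
  have q21 : q ^+ 2 = 1 by rewrite expr2 {1}qV mulVf.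
  by rewrite (exprM q 2 2) q21 expr1n.
case: n n_ge1 => // n _.
have [rho [rhoM rhoU]] := blob_module q_neq0 (@lin_extE k n.+1 _)
  (@eq_on_pure k n.+1 _) m q2 (tpow_proper k n.+1).
exists rho; split=> // i i0; rewrite rhoU /blob_gen.
  by rewrite opT_hecke // eqn0Ngt i0 /hecke addrC addKr.
by rewrite i0 opT1_hecke.
Qed.
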